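(* Consider the model in the context, let $0<\alpha<1$, and assume: (i) for every $0<x\le 1$, $\lim_{n\to\infty}P^S_{1,n}(x)=1$ and $\lim_{n\to\infty}P_{1,n}(x)=1$, and $P_{1,n}(x)$ is weakly increasing in $n$ for every $0\le x\le1$; (ii) with $S_m=S\cap\{1,\ldots,m\}$, $|S_m|/m\to c$ in probability as $m\to\infty$ for some constant $c>0$. Then \[ \operatorname*{plim}_{(m,n)\to\infty} q_{\alpha,m,n}(S_m)=\gamma_S, \] i.e. $q_{\alpha,m,n}(S_m)\to\gamma_S$ in probability as $m$ and $n$ tend to infinity jointly (at arbitrary relative rates).
   Context: Model: infinitely many hypotheses indexed by $i\in\mathbb{N}$, a (random) index set $T\subseteq\mathbb{N}$ of true null hypotheses and a (random) infinite subset of interest $S\subseteq\mathbb{N}$. For each sample size $n$, the $p$-values $p_{1,n},p_{2,n},\ldots$ are independent with marginal distribution $P_n(x)=\gamma x+(1-\gamma)P_{1,n}(x)$, $0\le x\le 1$, where $\gamma$ is the proportion of true nulls and $P_{1,n}(x)\ge x$ is a distribution function; conditionally on $i\in S$, $p_{i,n}$ independently has distribution $P^S_n(x)=\gamma_S x+(1-\gamma_S)P^S_{1,n}(x)$ with $\gamma_S\in[0,1]$ the proportion of true nulls within $S$ and $P^S_{1,n}(x)\ge x$ a distribution function; these distributions depend on $n$ but not on $m$. For given $m,n$, using $p_{1,n},\ldots,p_{m,n}$: for $I\subseteq\{1,\ldots,m\}$, $p_{(i:I)}$ is the $i$-th smallest of $\{p_{j,n}:j\in I\}$; Simes test: $I\in\mathcal{U}$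 iff some $1\le i\le|I|$ has $|I|p_{(i:I)}\le i\alpha$; closed testing $\mathcal{X}=\{I: J\in\mathcal{U}\ \forall J\supseteq I, J\subseteq\{1,\ldots,m\}\}$; $t_{\alpha,m,n}(A)=\max\{|I|:I\subseteq A, I\notin\mathcal{X}\}$; $q_{\alpha,m,n}(A)=t_{\alpha,m,n}(A)/|A|$ for $A\neq\emptyset$ and $0$ for $A=\emptyset$. *)

(* Defs.v *)
From HB Require Import structures.
From mathcomp Require Import all_boot all_order all_algebra.
From mathcomp Require Import all_classical all_reals all_analysis.
Set Implicit Arguments. Unset Strict Implicit. Unset Printing Implicit Defensive.
Import Order.TTheory GRing.Theory Num.Theory.
Import numFieldNormedType.Exports.
Local Open Scope classical_set_scope.
Local Open Scope ring_scope.

(* Convention: for fixed m, hypothesis number k (1 <= k <= m) is represented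
   by the ordinal i : 'I_m with k = i.+1.  A p-value realisation is a map
   p : nat -> R, p k being the p-value of hypothesis k. *)

Section Simes.
Variables (R : realType) (m : nat) (alpha : R) (p : nat -> R).

(* p_(i:I): the i-th smallest p-value among {p_j : j in I}, i = 1..|I| ;
   here indexed from 0: ord_stat I i = p_((i+1):I). *)
Definition ord_stat (I : {set 'I_m}) (i : nat) : R :=
  nth 0 (sort <=%R [seq p (val j).+1 | j in I]) i.

Definition simes_rej (I : {set 'I_m}) : bool :=
  [exists i : 'I_#|I|, #|I|%:R * ord_stat I i <= (i.+1)%:R * alpha].

Definition ct_rej (I : {set 'I_m}) : bool :=
  [forall J : {set 'I_m}, (I \subset J) ==> simes_rej J].

Definition t_bound (A : {set 'I_m}) : nat :=
  \max_(I : {set 'I_m} | (I \subset A) && ~~ ct_rej I) #|I|.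

Definition q_bound (A : {set 'I_m}) : R :=
  if A == finset.set0 then 0 else (t_bound A)%:R / (#|A|)%:R.

End Simes.

Definition S_restr (m : nat) (S : nat -> bool) : {set 'I_m} :=
  [set i : 'I_m | S (val i).+1].

Definition is_cdf01 (R : realType) (F : R -> R) : Prop :=
  [/\ forall x, 0 <= x <= 1 -> 0 <= F x,
      forall x y, 0 <= x -> x <= y -> y <= 1 -> F x <= F y,
      forall x, 0 <= x < 1 -> (F y @[y --> x^'+] --> F x)
    & F 1 = 1].

(* Main.v *)
Require Import Defs.
From HB Require Import structures.
From mathcomp Require Import all_boot all_order all_algebra.
From mathcomp Require Import all_classical all_reals all_analysis.
From mathcomp Require Import ring lra zify.
Import Order.TTheory GRing.Theory Num.Theory.
Import numFieldNormedType.Exports.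
Local Open Scope classical_set_scope.
Local Open Scope ring_scope.

(** Only the p-values in S matter. Given S, write N(x) for the number of i in S_m
with p_i <= x and F = P^S_n(x). The terms 1_{i in S} (1_{p_i <= x} - F) are
pairwise uncorrelated, so Chebyshev puts N(x) within eta m of F |S_m|
simultaneously for the finitely many x of a grid, with high probability as m grows
and uniformly in n; moreover |S_m| >= (c / 2) m. The rest is deterministic.

Upper bound: if I is included in S_m and some J containing I is accepted by Simes,
then at a fixed threshold x0 > 0 only a small fraction of I lies below x0, since
|J| <= m is comparable to |S_m|; but all but about gamma_S |S_m| of S_m lie below
x0 as n grows.

Lower bound: since P^S_n(x) <= 1 - gamma_S + gamma_S x, removing the
(1 - gamma_S + e) |S_m| smallest p-values from S_m leaves a set that Simes accepts,
alpha < 1 giving the room that absorbs the error terms. *)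

(** * Deterministic bounds for closed testing with Simes tests *)

Section Deterministic.
Context {R : realType} {m : nat}.
Variables (alpha : R) (p : nat -> R).
Implicit Types (A I J : {set 'I_m}) (x : R).

Definition below A x : {set 'I_m} := [set j in A | p (val j).+1 <= x].

Lemma below_le A x y : x <= y -> (#|below A x| <= #|below A y|)%N.
Proof.
move=> xy; apply/subset_leq_card/fintype.subsetP => j; rewrite !inE => /andP[-> /=].
by move/le_trans; apply.
Qed.

(** In a sorted sequence the entry at zero-based index [i] is at most [x] exactly when more than [i]
    entries are, so Simes becomes a statement about counts. *)
Lemma simes_rejE I : simes_rej alpha p I =
  [exists i : 'I_#|I|, (i < #|below I (i.+1%:R * alpha / #|I|%:R)|)%N].
Proof.
apply: eq_existsb => i; rewrite /ord_stat.
have I0 : 0 < #|I|%:R :> R by rewrite ltr0n (leq_trans _ (ltn_ord i)).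
rewrite mulrC -ler_pdivlMr//; set x := _ / _; set s := [seq p _ | j in I].
have srt : sorted <=%O (sort <=%R s) by apply: sort_sorted; exact: le_total.
have cnt : count (<= x) (sort <=%R s) = #|below I x|.
  rewrite (permP (permEl (perm_sort _ _))) /s /image_mem count_map -size_filter.
  rewrite cardE /enum_mem -filter_predI; congr size.
  by apply: eq_filter => j; rewrite /= !inE andbC.
have sz : size (sort <=%R s) = #|I| by rewrite size_sort size_image.
apply/idP/idP => [|h]; last first.
  by apply: (@nth_count_le _ _ _ 0 (sort <=%R s)); rewrite ?cnt.
apply: contraTT; rewrite -leqNgt -ltNge => h.
by apply: nth_count_gt; rewrite ?cnt ?sz ?h//=.
Qed.

Lemma simes_accP I : reflect (forall i, (i < #|I|)%N ->
    (#|below I (i.+1%:R * alpha / #|I|%:R)| <= i)%N) (~~ simes_rej alpha p I).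
Proof.
rewrite simes_rejE; apply: (iffP existsPn) => [h i iI|h i].
  by rewrite leqNgt; exact: (h (Ordinal iI)).
by rewrite -leqNgt h.
Qed.

Lemma ct_accP I : reflect
  (exists2 J : {set 'I_m}, I \subset J & ~~ simes_rej alpha p J)
  (~~ ct_rej alpha p I).
Proof.
apply: (iffP forallPn) => [[J]|[J IJ nJ]]; last by exists J; rewrite IJ.
by rewrite negb_imply => /andP[IJ nJ]; exists J.
Qed.

Lemma t_bound_ge A I : I \subset A -> ~~ ct_rej alpha p I ->
  (#|I| <= t_bound alpha p A)%N.
Proof.
move=> IA nI; rewrite /t_bound.
by apply: (@leq_bigmax_cond _ _ (fun I : {set 'I_m} => #|I|)); rewrite IA.
Qed.

Lemma t_bound_lt (A : {set 'I_m}) (b : R) : 0 < b ->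
  (forall I, I \subset A -> ~~ ct_rej alpha p I -> #|I|%:R < b) ->
  (t_bound alpha p A)%:R < b.
Proof.
move=> b0 h; rewrite /t_bound; apply: (big_ind (fun k : nat => k%:R < b)) => //.
  by move=> k l; rewrite /maxn; case: ifP.
by move=> I /andP[]; exact: h.
Qed.

Lemma q_boundE A : (0 < #|A|)%N ->
  q_bound alpha p A = (t_bound alpha p A)%:R / #|A|%:R.
Proof. by move=> A0; rewrite /q_bound -finset.cards_eq0 eqn0Ngt A0. Qed.

Lemma q_bound_ge0 A : 0 <= q_bound alpha p A.
Proof. by rewrite /q_bound; case: ifP => // _; rewrite divr_ge0. Qed.

(* A Simes-accepted superset J of I has at most about (e / 4) |A| p-values
   below x0, since |J| <= m is comparable to |A|. *)
Lemma q_bound_upper A (g e b x0 : R) :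
  0 < alpha -> 0 <= g -> 0 < e -> (0 < #|A|)%N -> b * m%:R <= #|A|%:R ->
  x0 <= e / 4 * b * alpha ->
  (1 - g - e / 2) * #|A|%:R <= #|below A x0|%:R ->
  q_bound alpha p A < g + e.
Proof.
move=> a0 g0 e0 A0 bA x0e cA.
have A0' : 0 < #|A|%:R :> R by rewrite ltr0n.
rewrite q_boundE// ltr_pdivrMr//; apply: t_bound_lt.
  by rewrite mulr_gt0//; lra.
move=> I IA /ct_accP[J IJ /simes_accP accJ]; rewrite ltNge; apply/negP => Ige.
have Age : e / 4 * #|A|%:R < #|I|%:R.
  by apply: lt_le_trans Ige; rewrite ltr_pM2r//; lra.
(* [i] is the integer part of [e / 4 * |A|]. As a rank in [J] its critical value is at least [x0]:
   for positive [x0], [x0 * |J| <= x0 * m <= e / 4 * |A| * alpha]. *)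
have /andP[ile ilt] : (Num.truncn (e / 4 * #|A|%:R))%:R <= e / 4 * #|A|%:R
    < (Num.truncn (e / 4 * #|A|%:R)).+1%:R.
  by apply: truncn_itv; rewrite mulr_ge0//; lra.
set i := Num.truncn _ in ile ilt.
have iI : (i < #|I|)%N by rewrite -(ltr_nat R) (le_lt_trans ile).
have iJ : (i < #|J|)%N by rewrite (leq_trans iI)// subset_leq_card.
have J0 : 0 < #|J|%:R :> R by rewrite ltr0n (leq_trans _ iJ).
have Jm : #|J|%:R <= m%:R :> R.
  by rewrite ler_nat -[X in (_ <= X)%N]card_ord max_card.
have x0i : x0 <= i.+1%:R * alpha / #|J|%:R.
  rewrite ler_pdivlMr//.
  have [x0n|x0p] := leP x0 0.
    apply: (@le_trans _ _ 0); last by rewrite mulr_ge0// ltW.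
    by rewrite mulr_le0_ge0.
  apply: (@le_trans _ _ (x0 * m%:R)); first by rewrite ler_pM2l.
  apply: (@le_trans _ _ (e / 4 * #|A|%:R * alpha)).
    apply: (@le_trans _ _ ((e / 4 * b * alpha) * m%:R)).
      by rewrite ler_wpM2r.
    rewrite (_ : _ * m%:R = e / 4 * (b * m%:R) * alpha); last by ring.
    by rewrite ler_pM2r// ler_pM2l//; lra.
  by rewrite ler_pM2r// ltW.
have cI : (#|below I x0| <= i)%N.
  apply: leq_trans (accJ i iJ); apply: leq_trans (below_le J _ _ x0i).
  apply/subset_leq_card/fintype.subsetP => j; rewrite !inE => /andP[jI ->].
  by rewrite (fintype.subsetP IJ).
(* Members of [I] above [x0] are members of [A] above [x0]. With [cI] and [cA] this gives
   [|I| <= (g + 3 * e / 4) * |A|], contradicting [Ige]. *)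
have split_card : (#|I| + #|below A x0| <= #|below I x0| + #|A|)%N.
  have -> : #|I| = (#|below I x0| + #|I :\: below I x0|)%N.
    rewrite -[LHS](cardsID (below I x0)); congr (_ + _)%N.
    by apply: eq_card => j; rewrite !inE; case: (j \in I).
  rewrite -addnA leq_add2l -(cardsID (below A x0) A) addnC leq_add//.
    by apply/subset_leq_card/fintype.subsetP => j; rewrite !inE; case: (j \in A).
  apply/subset_leq_card/fintype.subsetP => j; rewrite !inE.
  by have := fintype.subsetP IA j; case: (j \in I) => //= ->//; rewrite !andbT.
move: split_card; rewrite -(ler_nat R) !natrD.
move: cI; rewrite -(ler_nat R).
nra.
Qed.

(** Delete a minimal p-value [r] times. If any p-value is at most [x], so is the minimum, hence each
    deletion lowers the count at [x] by one until it is zero; truncated subtraction covers the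
    rest. *)
Lemma remove_smallest A (r : nat) : (r <= #|A|)%N ->
  exists I : {set 'I_m}, [/\ I \subset A, #|I| = (#|A| - r)%N &
    forall x, (#|below I x| <= #|below A x| - r)%N].
Proof.
elim: r => [_|r IH rA]; first by exists A; split=> [||x]; rewrite ?subn0.
have [I [IA cI bI]] := IH (ltnW rA).
have [j0 j0I] : exists j, j \in I.
  by apply/finset.set0Pn; rewrite -finset.cards_eq0 cI subn_eq0 -ltnNge.
case: (@Order.TotalTheory.arg_minP _ _ _ j0 (mem I)
  (fun j : 'I_m => p (val j).+1) j0I) => k.
move=> kI' kmin; have {kI'} kI : k \in I := kI'.
exists (I :\ k); split.
- exact: fintype.subset_trans (subD1set _ _) IA.
- by move: cI; rewrite (cardsD1 k) kI; lia.
move=> x; have [kx|kx] := boolP (k \in below I x).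
  have := bI x; rewrite (cardsD1 k) kx.
  suff -> : below I x :\ k = below (I :\ k) x by lia.
  by apply/setP => j; rewrite !inE andbA.
rewrite (_ : below _ _ = finset.set0) ?cards0//.
apply/setP => j; rewrite !inE; apply/negbTE/negP => /andP[/andP[_ jI] jx].
move/negP: kx; apply; rewrite inE kI/=; exact: le_trans (kmin _ jI) jx.
Qed.

(* Drop the (1 - g + e) |A| smallest p-values of A. The rest is accepted by
   Simes because above that level the empirical distribution of A grows with
   slope at most g, and alpha * (g - e + k) <= g - e. *)
Lemma q_bound_lower A (g e k : R) :
  0 < alpha < 1 -> 0 <= e -> e < g -> g <= 1 ->
  k <= e -> alpha * (g - e + k) <= g - e -> (0 < #|A|)%N ->
  (forall x, 0 <= x < 1 ->
     #|below A x|%:R + 1 <= (1 - g + g * x + k) * #|A|%:R) ->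
  g - e <= q_bound alpha p A.
Proof.
move=> /andP[a0 a1] e0 eg g1 ke ak A0 cA.
have A0' : 0 < #|A|%:R :> R by rewrite ltr0n.
(* [r] rounds [(1 - g + e) * |A|] down, losing less than one element; the [+ 1] in the counting
   hypothesis pays for this. *)
have h0 : 0 <= (1 - g + e) * #|A|%:R by rewrite mulr_ge0//; lra.
have /andP[rle rlt] := truncn_itv h0.
set r := Num.truncn _ in rle rlt.
have rA : (r <= #|A|)%N.
  rewrite -(ler_nat R); apply: le_trans rle _.
  by rewrite ger_pMl//; lra.
have [I [IA cI bI]] := @remove_smallest A r rA.
have Ige : (g - e) * #|A|%:R <= #|I|%:R.
  by rewrite cI natrB//; lra.
have I0 : 0 < #|I|%:R :> R by apply: lt_le_trans Ige; rewrite mulr_gt0//; lra.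
rewrite q_boundE// ler_pdivlMr//; apply: (le_trans Ige); rewrite ler_nat.
apply: t_bound_ge => //; apply/ct_accP; exists I => //; apply/simes_accP => i iI.
rewrite leqNgt; apply/negP => ilt.
set x := _ / _ in ilt.
have xI : x * #|I|%:R = i.+1%:R * alpha by rewrite /x divfK// gt_eqF.
have x0 : 0 <= x by rewrite divr_ge0// mulr_ge0// ltW.
(* Since [i.+1 <= |I|], [alpha < 1] keeps the critical value in the range of [cA]. *)
have x1 : x < 1.
  rewrite ltr_pdivrMr// mul1r; apply: (@lt_le_trans _ _ i.+1%:R).
    by rewrite gtr_pMr// ltr0n.
  by rewrite ler_nat.
have cAx := cA x; rewrite x0 x1 in cAx; move: {cAx}(cAx isT) => cAx.
have : (i.+1 + r <= #|below A x|)%N.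
  by rewrite addSn addnC -ltn_subRL (leq_trans ilt).
rewrite -(ler_nat R) natrD => iA.
have iA' : i.+1%:R < (g * x + k - e) * #|A|%:R by rewrite -natr1 in rlt; lra.
suff : i.+1%:R * alpha < x * #|I|%:R by rewrite xI ltxx.
apply: (@lt_le_trans _ _ ((g * x + k - e) * #|A|%:R * alpha)).
  by rewrite ltr_pM2r.
apply: (@le_trans _ _ (x * ((g - e) * #|A|%:R))); last by rewrite ler_wpM2l.
rewrite mulrAC [leRHS]mulrA ler_pM2r//.
(* The affine bound is replaced by a line through the origin, the gap being [(e - k) * (1 - x)];
   [ak] then applies. *)
apply: (@le_trans _ _ (x * (g - e + k) * alpha)).
  have : 0 <= (e - k) * (1 - x) by rewrite mulr_ge0//; lra.
  by rewrite ler_pM2r//; lra.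
by rewrite -mulrA ler_wpM2l// mulrC.
Qed.
End Deterministic.

(** * Measurability through finite codes, Chebyshev bound, grid approximation *)

Lemma measurable_of_finite_code (d : measure_display) (Omega : measurableType d)
    (I : finType) (f : Omega -> I -> bool) (E : set Omega) :
  (forall i, measurable [set w | f w i]) ->
  (forall w w', f w =1 f w' -> E w -> E w') ->
  measurable E.
Proof.
move=> mf Ef.
(* [E] is a finite union of fibres of the code, one for each value that it takes on [E]. *)
have -> : E = \bigcup_(t in [set t : {ffun I -> bool} |
      exists2 w, E w & f w =1 t])
    \bigcap_(i in [set: I]) [set w | f w i = t i].
  apply/seteqP; split=> [w Ew|w [t [w' Ew' ft] fw]].
    exists [ffun i => f w i] => [|i _ /=]; last by rewrite ffunE.
    by exists w => // i; rewrite ffunE.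
  by apply: Ef Ew' => i; rewrite ft fw.
apply: fin_bigcup_measurable => [|t _]; first exact: finite_finset.
apply: fin_bigcap_measurable => [|i _]; first exact: finite_finset.
case: (t i); first exact: mf.
rewrite (_ : mkset _ = ~` [set w | f w i]); first exact: measurableC.
by apply/seteqP; split=> w /=; case: (f w i).
Qed.

(** The two product hypotheses make all cross terms vanish, while the [B i] may depend on each other
    arbitrarily. Each diagonal term is at most 1, so the second moment is at most [m]. *)
Lemma second_moment_bound (R : realType) (d : measure_display)
    (Omega : measurableType d) (P : probability Omega R) (m : nat)
    (A B : 'I_m -> set Omega) (F a : R) :
  0 <= F <= 1 -> 0 < a ->
  (forall i, measurable (A i)) -> (forall i, measurable (B i)) ->
  (forall i j, i != j -> P (A i `&` A j) = (P (B i `&` B j) * (F * F)%:E)%E) ->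
  (forall i j, i != j -> P (A i `&` B j) = (P (B i `&` B j) * F%:E)%E) ->
  measurable [set w | a <= `|\sum_i (\1_(A i) w - F * \1_(B i) w)|] ->
  (P [set w | (a <= `|\sum_i (\1_(A i) w - F * \1_(B i) w)|)%R] <=
    (m%:R / a ^+ 2)%:E)%E.
Proof.
move=> /andP[F0 F1] a0 mA mB PAA PAB mE.
set E := [set w | _]; pose g i (w : Omega) : R := \1_(A i) w - F * \1_(B i) w.
(* The product [g i * g j], expanded so that its integral is a combination of four probabilities;
   the factor [1] gives all terms one shape. *)
pose u i j (w : Omega) : R := 1 * \1_(A i `&` A j) w
  + (- F) * \1_(A i `&` B j) w + (- F) * \1_(B i `&` A j) w
  + F * F * \1_(B i `&` B j) w.
have gE i j w : g i w * g j w = u i j w.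
  by rewrite /u /g !indicI /=; ring.
have intI (C : set Omega) (mC : measurable C) (k : R) :
    P.-integrable setT (EFin \o (fun w => k * \1_C w)).
  rewrite (_ : _ \o _ = fun w => (k%:E * (\1_C w)%:E)%E).
    by apply: integrableZl => //; exact: integrable_indic.
  by apply/funext => w; rewrite /= EFinM.
have RI (C : set Omega) (mC : measurable C) (k : R) :
    \int[P]_w (k * \1_C w) = k * fine (P C).
  rewrite RintegralZl//; last exact: integrable_indic.
  by rewrite /Rintegral integral_indic// setIT.
have mAA i j : measurable (A i `&` A j) by exact: measurableI.
have mAB i j : measurable (A i `&` B j) by exact: measurableI.
have mBA i j : measurable (B i `&` A j) by exact: measurableI.
have mBB i j : measurable (B i `&` B j) by exact: measurableI.
have intD (f h : Omega -> R) : P.-integrable setT (EFin \o f) ->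
    P.-integrable setT (EFin \o h) ->
    P.-integrable setT (EFin \o (fun w => f w + h w)).
  move=> intf inth; rewrite (_ : _ \o _ = (EFin \o f) \+ (EFin \o h))%E//.
  exact: integrableD.
have intu i j : P.-integrable setT (EFin \o u i j).
  by do 3 (apply: (intD); last by apply: intI); apply: intI.
have Iu i j : i != j -> \int[P]_w u i j w = 0.
  move=> ij; rewrite /u !RintegralD//; try by repeat (apply: (intD) || apply: intI).
  rewrite !RI//.
  rewrite PAA// PAB// (setIC (B i) (A j)) PAB 1?eq_sym// (setIC (B j)).
  rewrite !fineM//; try exact: fin_num_measure.
  rewrite /=; ring.
have Iuu i : \int[P]_w u i i w <= 1.
  apply: (@le_trans _ _ (\int[P]_w (1 * \1_setT w))); last first.
    by rewrite RI// probability_setT mul1r.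
  apply: le_Rintegral => // [|w _]; first exact: intI.
  rewrite -gE indicE in_setT mulr1 /g.
  rewrite !indicE; case: (w \in A i); case: (w \in B i) => /=; nra.
have intS (f : 'I_m -> Omega -> R) : (forall i, P.-integrable setT (EFin \o f i)) ->
    P.-integrable setT (EFin \o (fun w => \sum_i f i w)).
  move=> intf; rewrite (_ : _ \o _ = fun w => (\sum_i (EFin \o f i) w)%E).
    exact: integrable_sum.
  by apply/funext => w; rewrite /= sumEFin.
have RS (f : 'I_m -> Omega -> R) : (forall i, P.-integrable setT (EFin \o f i)) ->
    \int[P]_w (\sum_i f i w) = \sum_i \int[P]_w f i w.
  move=> intf; rewrite /Rintegral.
  under eq_integral do rewrite -sumEFin.
  rewrite integral_sum// -sum_fine// => i _.
  by apply: integrable_fin_num => //; exact: intf.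
(* Chebyshev: [a ^+ 2] times the indicator of [E] is at most the squared sum. *)
have key : a ^+ 2 * fine (P E) <= m%:R.
  rewrite -RI//; apply: (@le_trans _ _ (\int[P]_w (\sum_i \sum_j u i j w))).
    apply: le_Rintegral => // [||w _]; first exact: intI.
      by apply: (intS) => i; exact: intS.
    rewrite [leRHS](_ : _ = (\sum_i g i w) ^+ 2); last first.
      rewrite expr2 mulr_suml; apply: eq_bigr => i _; rewrite mulr_sumr.
      by apply: eq_bigr => j _; rewrite gE.
    rewrite indicE; have [/set_mem Ew|_] := boolP (w \in E); last first.
      by rewrite mulr0 sqr_ge0.
    by rewrite mulr1 -[leRHS]real_normK ?num_real// ler_sqr ?nnegrE// ltW.
  rewrite RS => [|i]; last exact: intS.
  apply: (@le_trans _ _ (\sum_(i < m) 1)); last by rewrite sumr_const card_ord.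
  apply: ler_sum => i _; rewrite RS// (bigD1 i)//= big1 ?addr0// => j ji.
  by rewrite Iu// eq_sym.
rewrite -[P E]fineK ?fin_num_measure// lee_fin ler_pdivlMr ?exprn_gt0//.
by rewrite mulrC.
Qed.

(** Rounding [x] up to the next multiple of [1 / K] can only raise the count and costs at most
    [g / K] in the bound; [x < 1] keeps that multiple at most 1. *)
Lemma below_grid (R : realType) (m : nat) (p : nat -> R) (A : {set 'I_m})
    (g h : R) (K : nat) : 0 <= g <= 1 -> (0 < K)%N ->
  (forall j, (j <= K)%N ->
     #|below p A (j%:R / K%:R)|%:R <= (1 - g + g * (j%:R / K%:R)) * #|A|%:R + h) ->
  forall x, 0 <= x < 1 ->
    #|below p A x|%:R <= (1 - g + g * x + K%:R^-1) * #|A|%:R + h.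
Proof.
move=> /andP[g0 g1] K0 hj x /andP[x0 x1].
have K0' : 0 < K%:R :> R by rewrite ltr0n.
have /andP[jle jlt] : (Num.truncn (x * K%:R))%:R <= x * K%:R
    < (Num.truncn (x * K%:R)).+1%:R by apply: truncn_itv; rewrite mulr_ge0// ltW.
set j := Num.truncn _ in jle jlt.
have jK : (j < K)%N.
  rewrite -(ltr_nat R); apply: le_lt_trans jle _.
  by rewrite gtr_pMl.
have xj : x <= j.+1%:R / K%:R by rewrite ler_pdivlMr// ltW.
have jx : j.+1%:R / K%:R <= x + K%:R^-1.
  by rewrite -natr1 mulrDl mul1r lerD2r ler_pdivrMr.
apply: (@le_trans _ _ (#|below p A (j.+1%:R / K%:R)|%:R)).
  by rewrite ler_nat below_le.
apply: le_trans (hj _ jK) _; rewrite lerD2r ler_wpM2r// -[leRHS]addrA lerD2l.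
apply: (@le_trans _ _ (g * (x + K%:R^-1))); first by rewrite ler_wpM2l.
by rewrite mulrDr lerD2l ler_piMl// invr_ge0 ltW.
Qed.

(** Simes tests see the p-values only through comparisons with finitely many critical values. This
    is what makes events about [q_bound] measurable. *)
Lemma simes_rej_congr (R : realType) (m : nat) (alpha : R) (p p' : nat -> R) :
  (forall (j : 'I_m) (i k : 'I_m.+1),
    (p j.+1 <= i%:R * alpha / k%:R) = (p' j.+1 <= i%:R * alpha / k%:R)) ->
  forall I : {set 'I_m}, simes_rej alpha p I = simes_rej alpha p' I.
Proof.
move=> pp' I; rewrite !simes_rejE; apply: eq_existsb => i; congr (_ < _)%N.
apply: eq_card => j; rewrite !inE; congr (_ && _).
have Im : (#|I| < m.+1)%N by rewrite ltnS -[X in (_ <= X)%N]card_ord max_card.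
have im : (i.+1 < m.+1)%N by rewrite ltnS (leq_trans (ltn_ord i)).
exact: (pp' j (Ordinal im) (Ordinal Im)).
Qed.

Lemma q_bound_congr (R : realType) (m : nat) (alpha : R) (p p' : nat -> R) :
  (forall I : {set 'I_m}, simes_rej alpha p I = simes_rej alpha p' I) ->
  forall A : {set 'I_m}, q_bound alpha p A = q_bound alpha p' A.
Proof.
move=> pp' A; rewrite /q_bound /t_bound; case: ifP => // _; congr (_%:R / _).
apply: eq_bigl => I; congr (_ && ~~ _); apply: eq_forallb => J.
by rewrite pp'.
Qed.

(** * Random counts under the model *)

Section Model.
Context {R : realType} {d : measure_display} {Omega : measurableType d}.
Variables (P : probability Omega R) (S : Omega -> nat -> bool).
Variable p : nat -> Omega -> R.
Hypothesis mS : forall i, measurable [set w | S w i].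
Hypothesis mp : forall i, measurable_fun setT (p i).

Lemma measurable_p_le i x : measurable [set w | p i w <= x].
Proof.
have := mp i measurableT _ (measurable_itv `]-oo, x]); rewrite setTI.
by rewrite (_ : _ @^-1` _ = [set w | p i w <= x]).
Qed.

Lemma measurable_q_bound (m : nat) (alpha : R) (Q : set R) :
  measurable [set w | Q (q_bound alpha (p ^~ w) (S_restr m (S w)))].
Proof.
pose f w (t : 'I_m + 'I_m * 'I_m.+1 * 'I_m.+1) := match t with
  | inl i => S w i.+1
  | inr (j, i, k) => p j.+1 w <= i%:R * alpha / k%:R end.
apply: (@measurable_of_finite_code _ _ _ f) => [[i|[[j i] k]]|w w' ff' /=].
- exact: mS.
- exact: measurable_p_le.
rewrite (@q_bound_congr _ _ _ _ (p ^~ w')).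
  rewrite (_ : S_restr _ _ = S_restr m (S w'))//.
  by apply/setP => i; rewrite !inE; exact: (ff' (inl i)).
by apply: simes_rej_congr => j i k; exact: (ff' (inr (j, i, k))).
Qed.

Lemma measurable_counts (m : nat) (x : R) (Q : nat -> nat -> Prop) :
  measurable [set w | Q #|S_restr m (S w)| #|below (p ^~ w) (S_restr m (S w)) x|].
Proof.
pose f w (t : 'I_m + 'I_m) := match t with
  | inl i => S w i.+1 | inr i => p i.+1 w <= x end.
apply: (@measurable_of_finite_code _ _ _ f) => [[i|i]|w w' ff' /=].
- exact: mS.
- exact: measurable_p_le.
have -> : S_restr m (S w) = S_restr m (S w').
  by apply/setP => i; rewrite !inE; exact: (ff' (inl i)).
suff -> : below (p ^~ w) (S_restr m (S w')) x =
  below (p ^~ w') (S_restr m (S w')) x by [].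
by apply/setP => i; rewrite !inE; congr (_ && _); exact: (ff' (inr i)).
Qed.

Lemma indic_bool (f : Omega -> bool) w : \1_[set w | f w] w = (f w)%:R :> R.
Proof.
by rewrite indicE; congr (nat_of_bool _)%:R; apply/idP/idP => [/set_mem|/mem_set].
Qed.

Lemma card_S_restr m w : #|S_restr m (S w)|%:R =
  \sum_(i < m) \1_[set w | S w i.+1] w :> R.
Proof.
rewrite -sum1_card natr_sum big_mkcond; apply: eq_bigr => i _.
by rewrite inE (indic_bool (fun w => S w i.+1)); case: (S w i.+1).
Qed.

Lemma card_below_S_restr m w x : #|below (p ^~ w) (S_restr m (S w)) x|%:R =
  \sum_(i < m) \1_([set w | S w i.+1] `&` [set w | p i.+1 w <= x]) w :> R.
Proof.
rewrite -sum1_card natr_sum big_mkcond; apply: eq_bigr => i _.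
rewrite !inE indicI/= (indic_bool (fun w => S w i.+1)).
rewrite (indic_bool (fun w => p i.+1 w <= x)).
by case: (S w i.+1); case: (_ <= x); rewrite ?mulr0 ?mul0r ?mulr1.
Qed.

(** The second moment bound, with [B i] the event that hypothesis [i.+1] lies in [S] and [A i] the
    part of it where the p-value is at most [x]. *)
Lemma count_deviation (m : nat) (x F a : R) : 0 <= F <= 1 -> 0 < a ->
  (forall (s : seq nat) (E : set Omega), uniq s ->
     <<s [set [set w | S w i] | i in [set: nat]] >> E ->
     E `<=` [set w | forall i, i \in s -> S w i] ->
     P (E `&` [set w | forall i, i \in s -> p i w <= x]) =
     (P E * (\prod_(i <- s) F)%:E)%E) ->
  (P [set w | (a <= `| #|below (p ^~ w) (S_restr m (S w)) x|%:R
                       - F * #|S_restr m (S w)|%:R |)%R] <= (m%:R / a ^+ 2)%:E)%E.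
Proof.
move=> F01 a0 cond.
pose B (i : 'I_m) := [set w | S w i.+1].
pose A (i : 'I_m) := B i `&` [set w | p i.+1 w <= x].
have sB (i : 'I_m) : <<s [set [set w | S w i] | i in [set: nat]] >> (B i).
  by apply: sub_gen_smallest; exists i.+1.
have sBB (i j : 'I_m) :
    <<s [set [set w | S w i] | i in [set: nat]] >> (B i `&` B j).
  exact: (@measurableI _ (g_sigma_algebraType
    [set [set w | S w i] | i in [set: nat]]) _ _ (sB i) (sB j)).
have E w : #|below (p ^~ w) (S_restr m (S w)) x|%:R - F * #|S_restr m (S w)|%:R
    = \sum_i (\1_(A i) w - F * \1_(B i) w).
  by rewrite card_S_restr card_below_S_restr mulr_sumr -sumrB.
have -> : [set w | (a <= `| #|below (p ^~ w) (S_restr m (S w)) x|%:R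
                       - F * #|S_restr m (S w)|%:R |)%R] =
  [set w | a <= `|\sum_i (\1_(A i) w - F * \1_(B i) w)|].
  by apply/funext => w /=; rewrite E.
apply: second_moment_bound => //.
- by move=> i; apply: measurableI; [exact: mS|exact: measurable_p_le].
- by move=> i; exact: mS.
(* Given both memberships, constraining both p-values yields [F * F]; constraining only the first,
   in the next case, yields [F]. *)
- move=> i j ij; have := cond [:: i.+1; j.+1] (B i `&` B j).
  rewrite big_cons big_seq1 => <- //.
  + congr (P _); apply/seteqP; split=> [w [[Bi pi] [Bj pj]]|w [[Bi Bj] pij]].
      by split=> // k; rewrite !inE => /orP[] /eqP ->.
    by do 2 split=> //; apply: pij; rewrite !inE eqxx ?orbT.
  + by rewrite /= inE eqSS -val_eqE in ij *; rewrite ij.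
  + by move=> w [Bi Bj] k; rewrite !inE => /orP[] /eqP ->.
- move=> i j ij; have := cond [:: i.+1] (B i `&` B j).
  rewrite big_seq1 => <- //.
  + congr (P _); apply/seteqP; split=> [w [[Bi pi] Bj]|w [[Bi Bj] pij]].
      by split=> // k; rewrite !inE => /eqP ->.
    by do 2 split=> //; apply: pij; rewrite !inE eqxx.
  + by move=> w [Bi Bj] k; rewrite !inE => /eqP ->.
rewrite (_ : mkset _ = [set w | a <= `| #|below (p ^~ w) (S_restr m (S w)) x|%:R
                       - F * #|S_restr m (S w)|%:R |]).
  exact: (@measurable_counts m x (fun M N => a <= `|N%:R - F * M%:R|)).
by apply/funext => w /=; rewrite E.
Qed.

End Model.

(** * Union bound and the estimate on the good event *)

Lemma probability_seq_union (R : realType) (d : measure_display)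
    (Omega : measurableType d) (P : probability Omega R) (T : eqType)
    (s : seq T) (B : T -> set Omega) (b : R) :
  (forall x, measurable (B x)) -> (forall x, x \in s -> (P (B x) <= b%:E)%E) ->
  (P (\big[setU/set0]_(x <- s) B x) <= ((size s)%:R * b)%:E)%E.
Proof.
move=> mB; elim: s => [|x s IH] Pb; first by rewrite big_nil measure0 mul0r.
rewrite big_cons; apply: le_trans (measureU2 _ _ _) _ => //.
  exact: bigsetU_measurable.
have -> : ((size (x :: s))%:R * b)%:E = (b%:E + ((size s)%:R * b)%:E)%E.
  by rewrite -EFinD /= -natr1; congr EFin; ring.
apply: leeD; first by rewrite Pb// mem_head.
by apply: IH => y ys; rewrite Pb// inE ys orbT.
Qed.

(** Combines both deterministic bounds at a realisation where [A] is large and the counts at [x0]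
    and on the grid deviate by less than [eta * m]. *)
Lemma q_bound_close (R : realType) (m K : nat) (p : nat -> R) (A : {set 'I_m})
    (F : R -> R) (alpha g eps b x0 k eta : R) :
  0 < alpha < 1 -> 0 <= g <= 1 -> 0 < eps -> 0 < b -> (0 < m)%N -> (0 < K)%N ->
  b * m%:R <= #|A|%:R -> x0 <= eps / 4 * b * alpha ->
  eta <= b * eps / 4 -> eta <= b * k / 4 -> 1 <= eta * m%:R ->
  K%:R^-1 <= k / 2 -> k <= eps / 2 ->
  (eps / 2 < g -> alpha * (g - eps / 2 + k) <= g - eps / 2) ->
  1 - g - eps / 4 <= F x0 ->
  (forall j, (j <= K)%N -> F (j%:R / K%:R) <= 1 - g + g * (j%:R / K%:R)) ->
  (forall x, x \in x0 :: [seq j%:R / K%:R | j <- iota 0 K.+1] ->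
     `| #|below p A x|%:R - F x * #|A|%:R | < eta * m%:R) ->
  `|q_bound alpha p A - g| < eps.
Proof.
move=> a01 g01 e0 b0 m0 K0 bA x0e eta1 eta2 m1 Kk ke ak Fx0 FK dev.
have /andP[a0 a1] := a01; have /andP[g0 g1] := g01.
have m0' : 0 < m%:R :> R by rewrite ltr0n.
have A0' : 0 < #|A|%:R :> R by apply: lt_le_trans bA; rewrite mulr_gt0.
have A0 : (0 < #|A|)%N by rewrite -(ltr0n R).
have scale (r : R) : 0 <= r -> eta <= b * r / 4 -> eta * m%:R <= r / 4 * #|A|%:R.
  move=> r0 etar; apply: (@le_trans _ _ (b * r / 4 * m%:R)).
    by rewrite ler_pM2r.
  rewrite (_ : _ * m%:R = r / 4 * (b * m%:R)); last by ring.
  by rewrite ler_wpM2l// divr_ge0.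
have k0 : 0 <= k.
  by apply: le_trans (_ : 2 * K%:R^-1 <= k); [rewrite mulr_ge0// invr_ge0|lra].
rewrite ltr_distl; apply/andP; split; last first.
  apply: (@q_bound_upper _ _ _ _ _ g eps b x0) => //.
  (* The allowance [eps / 2] is spent half on [F x0] and half on the deviation. *)
  have := dev x0 (mem_head _ _); rewrite ltr_distl => /andP[+ _].
  have := scale eps (ltW e0) eta1.
  have : (1 - g - eps / 4) * #|A|%:R <= F x0 * #|A|%:R by rewrite ler_pM2r.
  lra.
(* For [g <= eps / 2] the lower bound is negative and nonnegativity of [q_bound] suffices. *)
have [eg|ge] := ltP (eps / 2) g; last first.
  by apply: lt_le_trans (q_bound_ge0 _ _ _); lra.
apply: (@lt_le_trans _ _ (g - eps / 2)); first by lra.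
apply: (@q_bound_lower _ _ _ _ _ g (eps / 2) k) => //; [lra|exact: ak|].
move=> x x01.
have bx : #|below p A x|%:R <= (1 - g + g * x + K%:R^-1) * #|A|%:R + eta * m%:R.
  apply: below_grid x01 => // j jK.
  have : j%:R / K%:R \in x0 :: [seq j%:R / K%:R | j <- iota 0 K.+1].
    rewrite inE; apply/orP; right.
    by apply: (map_f (fun j : nat => j%:R / K%:R)); rewrite mem_iota.
  move/dev; rewrite ltr_distl => /andP[_ /ltW/le_trans]; apply.
  by rewrite lerD2r ler_pM2r// FK.
(* The slack [k] splits into [k / 2] for the mesh, [k / 4] for the deviation and [k / 4] for the
   extra 1. *)
have := scale k k0 eta2.
have : K%:R^-1 * #|A|%:R <= k / 2 * #|A|%:R by rewrite ler_pM2r.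
lra.
Qed.

(** * Choice of constants and convergence in probability *)

Theorem theorem3 (R : realType) (d : measure_display) (Omega : measurableType d)
  (P : probability Omega R)
  (gamma gammaS : R) (P1 PS1 : nat -> R -> R)
  (S : Omega -> nat -> bool) (pv : nat -> nat -> Omega -> R)
  (alpha c : R) :
  (* model *)
  0 <= gamma <= 1 -> 0 <= gammaS <= 1 ->
  (forall n, is_cdf01 (P1 n)) -> (forall n, is_cdf01 (PS1 n)) ->
  (forall n x, 0 <= x <= 1 -> x <= P1 n x) ->
  (forall n x, 0 <= x <= 1 -> x <= PS1 n x) ->
  (forall n i, measurable_fun setT (pv n i)) ->
  (forall n i w, 0 <= pv n i w <= 1) ->
  (forall i, measurable [set w | S w i]) ->
  (forall w, infinite_set [set i | S w i]) ->
  (* for each n, p_{1,n}, p_{2,n}, ... independent with marginal P_n *)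
  (forall n (F : seq nat) (x : nat -> R), uniq F ->
     (forall i, 0 <= x i <= 1) ->
     P [set w | forall i, i \in F -> pv n i w <= x i] =
     (\prod_(i <- F) (gamma * x i + (1 - gamma) * P1 n (x i)))%:E) ->
  (* conditionally on S, the p_{i,n} with i in S are independent with
     distribution P^S_n *)
  (forall n (F : seq nat) (x : nat -> R) (E : set Omega), uniq F ->
     (forall i, 0 <= x i <= 1) ->
     <<s [set [set w | S w i] | i in [set: nat]] >> E ->
     E `<=` [set w | forall i, i \in F -> S w i] ->
     P (E `&` [set w | forall i, i \in F -> pv n i w <= x i]) =
     (P E * (\prod_(i <- F) (gammaS * x i + (1 - gammaS) * PS1 n (x i)))%R%:E)%E) ->
  0 < alpha < 1 ->
  (* (i) *)
  (forall x, 0 < x <= 1 -> (fun n => PS1 n x) @ \oo --> (1 : R)) ->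
  (forall x, 0 < x <= 1 -> (fun n => P1 n x) @ \oo --> (1 : R)) ->
  (forall n x, 0 <= x <= 1 -> P1 n x <= P1 n.+1 x) ->
  (* (ii) |S_m|/m -> c in probability, c > 0 *)
  0 < c ->
  (forall eps : R, 0 < eps ->
     (fun m : nat =>
        P [set w | eps <= `| (#|S_restr m (S w)|)%:R / m%:R - c | ]) @ \oo
     --> 0%E) ->
  (* conclusion: q_{alpha,m,n}(S_m) -> gammaS in probability as (m,n) -> oo *)
  forall eps delta : R, 0 < eps -> 0 < delta ->
  exists N : nat, forall m n : nat, (N <= m)%N -> (N <= n)%N ->
    (P [set w | (eps <= `| q_bound alpha (fun i => pv n i w) (S_restr m (S w))
                          - gammaS |)%R ] <= delta%:E)%E.
Proof.
move=> _ g01 _ cdfS _ _ mp _ mS _ _ cond a01 PS1_1 _ _ c0 cS eps delta eps0 delta0.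
have /andP[a0 a1] := a01; have /andP[g0 g1] := g01.
have PS1_le n x : 0 <= x <= 1 -> PS1 n x <= 1.
  by case: (cdfS n) => _ mono _ PS11 /andP[x0 x1]; rewrite -[leRHS]PS11 mono.
have PS1_ge0 n x : 0 <= x <= 1 -> 0 <= PS1 n x.
  by case: (cdfS n) => PS1_0 _ _ _; exact: PS1_0.
pose F n x := gammaS * x + (1 - gammaS) * PS1 n x.
have F_le n x : 0 <= x <= 1 -> F n x <= 1 - gammaS + gammaS * x.
  by move=> x01; rewrite /F addrC lerD2r ler_piMr ?subr_ge0// PS1_le.
have F_ge0 n x : 0 <= x <= 1 -> 0 <= F n x.
  move=> x01; rewrite addr_ge0// mulr_ge0 ?PS1_ge0 ?subr_ge0//.
  by case/andP: x01.
pose b := c / 2; have b0 : 0 < b by rewrite divr_gt0.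
(* The cap at 1 keeps [x0] where the distribution functions are controlled. *)
pose x0 := Num.min 1 (eps / 4 * b * alpha).
have x0_gt0 : 0 < x0.
  by rewrite lt_min ltr01 !mulr_gt0// invr_gt0.
have x0_le1 : x0 <= 1 by rewrite ge_min lexx.
have [k [k0 ke ak]] : exists k, [/\ 0 < k, k <= eps / 2 &
    (eps / 2 < gammaS ->
     alpha * (gammaS - eps / 2 + k) <= gammaS - eps / 2)].
  have [eg|ge] := ltP (eps / 2) gammaS; last by exists (eps / 2); split=> //; lra.
  (* With [h = gammaS - eps / 2], [alpha * (h + k) <= h] follows from
     [alpha * k <= k <= h * (1 - alpha)]. *)
  exists (Num.min (eps / 2) ((gammaS - eps / 2) * (1 - alpha))); split.
  - by rewrite lt_min; apply/andP; split; [lra|apply: mulr_gt0; lra].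
  - by rewrite ge_min lexx.
  move=> _; set k := Num.min _ _.
  have k1 : k <= (gammaS - eps / 2) * (1 - alpha) by rewrite ge_min lexx orbT.
  have k0 : 0 <= k by rewrite le_min; apply/andP; split; [lra|apply: mulr_ge0; lra].
  have : alpha * k <= k by rewrite ler_piMl// ltW.
  lra.
pose K := (Num.truncn (2 / k)).+1.
have Kk : K%:R^-1 <= k / 2.
  rewrite -[k / 2]invrK invf_div lef_pV2 ?posrE ?divr_gt0// ltW//.
  exact: truncnS_gt.
pose eta := Num.min (b * eps / 4) (b * k / 4).
have eta0 : 0 < eta by rewrite lt_min !divr_gt0 ?mulr_gt0.
have [N1 _ hN1] : \forall m \near \oo,
    (P [set w | (b <= `| #|S_restr m (S w)|%:R / m%:R - c|)%R] < (delta / 2)%:E)%E.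
  have /= := cS b b0 [set y | (y < (delta / 2)%:E)%E]; apply.
  by apply: open_ereal_lt'; rewrite lte_fin divr_gt0.
have [N2 _ hN2] : \forall n \near \oo, 1 - eps / 4 < PS1 n x0.
  have /cvgr_gt : (fun n => PS1 n x0) @ \oo --> (1 : R).
    by apply: PS1_1; rewrite x0_gt0.
  by apply; lra.
pose s := x0 :: [seq j%:R / K%:R | j <- iota 0 K.+1] : seq R.
have s01 x : x \in s -> 0 <= x <= 1.
  rewrite inE => /predU1P[->|/mapP[j]]; first by rewrite ltW.
  rewrite mem_iota ltnS => /andP[_ jK] ->.
  by rewrite divr_ge0//= ler_pdivrMr ?ltr0n// mul1r ler_nat.
(* The first entry forces [1 <= eta * m], the second brings the union bound below [delta / 2]. [C]
   and [N1] constrain only [m], and [N2] only [n], so the relative rates are arbitrary. *)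
pose C := Num.max eta^-1 (2 * (size s)%:R / (eta ^+ 2 * delta)).
exists (maxn (maxn N1 N2) (Num.truncn C).+1) => m n.
rewrite !geq_max => /andP[/andP[N1m _] Cm] /andP[/andP[_ N2n] _].
have {}Cm : C < m%:R by apply: lt_le_trans (truncnS_gt _) _; rewrite ler_nat.
have m0 : 0 < m%:R :> R by apply: lt_trans Cm; rewrite lt_max invr_gt0 eta0.
have m0n : (0 < m)%N by rewrite -(ltr0n R).
have etam : 1 <= eta * m%:R.
  rewrite -ler_pdivrMl// mulr1; apply: le_trans (ltW Cm).
  by rewrite le_max lexx.
pose B0 := [set w | b <= `| #|S_restr m (S w)|%:R / m%:R - c|].
pose dev x := [set w | eta * m%:R <=
  `| #|below (fun i => pv n i w) (S_restr m (S w)) x|%:R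
     - F n x * #|S_restr m (S w)|%:R |].
have mdev x : measurable (dev x).
  exact: (@measurable_counts _ _ _ S (pv n) mS (mp n) m x
    (fun M N => eta * m%:R <= `|N%:R - F n x * M%:R|)).
(* The predicate ignores the second count, so the threshold 0 is arbitrary. *)
have mB0 : measurable B0.
  exact: (@measurable_counts _ _ _ S (pv n) mS (mp n) m 0
    (fun M N => b <= `|M%:R / m%:R - c|)).
have Pdev x : x \in s -> (P (dev x) <= (m%:R / (eta * m%:R) ^+ 2)%:E)%E.
  move=> /s01 x01; apply: count_deviation => //.
  - rewrite F_ge0//=; apply: le_trans (F_le _ _ x01) _.
    case/andP: x01 => x00 x11; have : gammaS * x <= gammaS by rewrite ler_piMr.
    lra.
  - by rewrite mulr_gt0.
  by move=> t E ut sE Et; exact: (cond n t (fun=> x) E ut (fun=> x01) sE Et).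
have mU : measurable (\big[setU/set0]_(x <- s) dev x).
  by apply: bigsetU_measurable => x _; exact: mdev.
apply: (@le_trans _ _ (P (B0 `|` \big[setU/set0]_(x <- s) dev x))).
  apply: le_measure; rewrite ?inE.
  - exact: (@measurable_q_bound _ _ _ S (pv n) mS (mp n) m alpha
      (fun q => eps <= `|q - gammaS|)).
  - exact: measurableU.
  (* Outside [B0] and every [dev x] the estimate on the good event applies. *)
  move=> w /= epsq; apply: contrapT => /not_orP[/negP nB0 ndev].
  move: epsq; rewrite leNgt => /negP; apply.
  apply: (@q_bound_close _ m K _ _ (F n) alpha gammaS eps b x0 k eta) => //.
  - move: nB0; rewrite -ltNge ltr_distl => /andP[+ _].
    by rewrite ltr_pdivlMr// => /ltW; apply: le_trans; rewrite /b ler_pM2r//; lra.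
  - by rewrite ge_min lexx orbT.
  - by rewrite ge_min lexx.
  - by rewrite ge_min lexx orbT.
  (* [F n x0] is at least [(1 - gammaS) * (1 - eps / 4)], which exceeds the target by
     [gammaS * eps / 4]. *)
  - have := hN2 n N2n; rewrite /= => PSx.
    have : 0 <= gammaS * x0 by rewrite mulr_ge0// ltW.
    have : (1 - gammaS) * (1 - eps / 4) <= (1 - gammaS) * PS1 n x0.
      by rewrite ler_wpM2l ?subr_ge0// ltW.
    have : 0 <= gammaS * eps by rewrite mulr_ge0// ltW.
    rewrite /F; lra.
  - move=> j jK; apply: F_le; apply: s01; rewrite inE; apply/orP; right.
    by apply: (map_f (fun j : nat => j%:R / K%:R)); rewrite mem_iota.
  move=> x xs; rewrite ltNge; apply/negP => xdev; apply: ndev.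
  by rewrite -bigcup_seq; exists x.
apply: le_trans (measureU2 _ _ _) _ => //.
rewrite [delta]splitr EFinD; apply: leeD; first exact: ltW (hN1 m N1m).
apply: le_trans (probability_seq_union _ _ _ _ _ _ _ _ mdev Pdev) _.
rewrite lee_fin.
(* The number of thresholds is fixed, so the total decays like [1 / m], uniformly in [n]. *)
have -> : (size s)%:R * (m%:R / (eta * m%:R) ^+ 2) = (size s)%:R / eta ^+ 2 / m%:R.
  by field; rewrite !gt_eqF.
rewrite ler_pdivrMr//.
have : 2 * (size s)%:R / (eta ^+ 2 * delta) <= m%:R.
  by apply: le_trans (ltW Cm); rewrite le_max lexx orbT.
rewrite ler_pdivrMr ?mulr_gt0 ?exprn_gt0// => h.
rewrite ler_pdivrMr ?exprn_gt0//; lra.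
Qed.
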